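(* Let $\Omega$ be a basic set of an Axiom A diffeomorphism $f$, let $\mathcal{R}=\{R_1,\dots,R_m\}$ be a Markov partition of $\Omega$ with transition matrix $A$, and let $\Sigma_A\subset\{1,\dots,m\}^{\mathbb{Z}}$ be the two-sided subshift of finite type defined by $A$. Then there exists a continuous surjection $\pi:\Sigma_A\to\Omega$ satisfying: (i) $\pi\circ\sigma=f\circ\pi$, where $\sigma$ is the shift on $\Sigma_A$. (ii) For each $a\in\Sigma_A$, $\bigcap_{n\in\mathbb{Z}}f^{-n}(R_{a_n})$ is a single point, and $\pi(a)$ is this point. (iii) $\pi$ is injective on $\pi^{-1}(Y)$, where $Y$ is the good set. (iv) For $x\in Y$, $\pi^{-1}(x)=\{a(x)\}$, where $a(x)$ is the itinerary of $x$.
   Context: A compact $f$-invariant set is hyperbolic if there is a continuous $Df$-invariant splitting $E^s\oplus E^u$ of the tangent bundle over it and constants $c>0,\lambda\in(0,1)$ with $\|Df^n_xv\|\le c\lambda^n\|v\|$ for $v\in E^s_x$ and $\|Df^{-n}_xv\|\le c\lambda^n\|v\|$ for $v\in E^u_x$, $n\ge0$. A $C^r$ diffeomorphism ($r\ge1$) $f$ of a compact Riemannian manifold $M$ satisfies Axiom A if its nonwandering set $\Omega(f)$ is hyperbolic and periodic points are dense in it. Basic sets are the members of the unique finite decomposition of $\Omega(f)$ into pairwise disjoint closed $f$-invariant sets on which $f$ is topologically transitive (each further being a finite disjoint union of closed sets cyclically permuted by $f$ on which the return power of $f$ is topologically mixing). $W^s_\varepsilon(x)=\{y: d(f^n(x),f^n(y))\le\varepsilon\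 \forall n\ge0\}$, $W^u_\varepsilon(x)=\{y: d(f^{-n}(x),f^{-n}(y))\le\varepsilon\ \forall n\ge0\}$. A small $\varepsilon$ and $\delta_0>0$ are fixed such that for $x,y\in\Omega$ with $d(x,y)<\delta_0$, $W^s_\varepsilon(x)\cap W^u_\varepsilon(y)$ is a single point $[x,y]\in\Omega$. $R\subset\Omega$ is a rectangle if $\mathrm{diam}(R)<\delta_0$ and $[x,y]\in R$ for all $x,y\in R$; it is proper if closed and $R=\overline{\mathrm{int}(R)}$ (interior in $\Omega$). $W^s(x,R)=W^s_\varepsilon(x)\cap R$, $W^u(x,R)=W^u_\varepsilon(x)\cap R$, where $\varepsilon$ is larger than $\mathrm{diam}(R)$. A Markov partition of $\Omega$ is a finite collection $\{R_1,\dots,R_m\}$ of proper rectangles with $\Omega=\bigcup_iR_i$; $\mathrm{int}(R_i)\cap\mathrm{int}(R_j)=\emptyset$ for $i\ne j$; and for $x\in\mathrm{int}(R_i)\cap f^{-1}(\mathrm{int}(R_j))$, $f(W^u(x,R_i))\supset W^u(f(x),R_j)$ and $f(W^s(x,R_i))\subset W^s(f(x),R_j)$. The transition matrix is $A_{ij}=1$ if $\mathrm{int}(R_i)\cap f^{-1}(\mathrm{int}(R_j))\ne\emptyset$, and $A_{ij}=0$ otherwise. $\Sigma_A=\{(a_i)_{i\in\mathbb{Z}}: A_{a_ia_{i+1}}=1\ \forall i\}$ with the metric $d(a,b)=2^{-\min\{|i|:a_i\neq b_i\}}$ ($d(a,a)=0$), and $(\sigma a)_i=a_{i+1}$. Boundaries: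 $\partial^sR=\{x\in R: x\notin\mathrm{int}(W^u(x,R))\}$, $\partial^uR=\{x\in R:x\notin\mathrm{int}(W^s(x,R))\}$, interiors taken in $W^u_\varepsilon(x)\cap\Omega$ and $W^s_\varepsilon(x)\cap\Omega$ respectively; $\partial^s\mathcal{R}=\bigcup_j\partial^sR_j$, $\partial^u\mathcal{R}=\bigcup_j\partial^uR_j$. The good set is $Y=\Omega\setminus\bigcup_{n\in\mathbb{Z}}f^n(\partial^s\mathcal{R}\cup\partial^u\mathcal{R})$. For $x\in Y$ the itinerary is the sequence $a(x)=(a_i)_{i\in\mathbb{Z}}$ determined by $f^i(x)\in R_{a_i}$ for all $i$. *)

(* Defs.v *)
From HB Require Import structures.
From mathcomp Require Import all_boot all_order all_algebra.
From mathcomp Require Import all_classical all_reals all_analysis.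

Set Implicit Arguments.
Unset Strict Implicit.
Unset Printing Implicit Defensive.

Import Order.TTheory GRing.Theory Num.Theory.
Import numFieldNormedType.Exports.

Local Open Scope classical_set_scope.
Local Open Scope ring_scope.

(* To be used with [U] open, so that ['d f x] only depends on [f] inside [U]. *)
Fixpoint Ck_on (R : realType) (V W : normedModType R) (k : nat) (U : set V)
    (f : V -> W) {struct k} : Prop :=
  match k with
  | 0%N => {in U, continuous f}
  | k'.+1 => (forall x, U x -> differentiable f x) /\
             (forall v, Ck_on k' U (fun x => 'd f x v))
  end.

(* A C^oo manifold without boundary whose topology is that of a metric; the
   atlas need not be maximal.  [chart_inv i] is meaningful only on
   [chart i @` dom i].  [chart_at] selects one chart around each point; it only
   serves to name tangent vectors, see [tangent]. *)
Record smoothManifold (R : realType) (n : nat) := SmoothManifold {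
  carrier :> metricType R ;
  atlas : Type ;
  dom : atlas -> set carrier ;
  chart : atlas -> carrier -> 'rV[R]_n ;
  chart_inv : atlas -> 'rV[R]_n -> carrier ;
  dom_open : forall i, open (dom i) ;
  codom_open : forall i, open (chart i @` dom i) ;
  chartK : forall i, {in dom i, cancel (chart i) (chart_inv i)} ;
  chart_continuous : forall i, {in dom i, continuous (chart i)} ;
  chart_inv_continuous :
    forall i, {in chart i @` dom i, continuous (chart_inv i)} ;
  transition_smooth : forall i j k,
    Ck_on k (chart i @` (dom i `&` dom j)) (chart j \o chart_inv i) ;
  chart_at : carrier -> atlas ;
  chart_at_dom : forall x, dom (chart_at x) x
}.
Arguments dom {R n s}.
Arguments chart {R n s}.
Arguments chart_inv {R n s}.
Arguments chart_at {R n s}.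

(* T_xM, a vector being given by its coordinates in the chart [chart_at x]. *)
Definition tangent (R : realType) (n : nat) (M : smoothManifold R n) (x : M) :=
  'rV[R]_n.

Section Derivatives.
Context {R : realType} {n : nat} {M : smoothManifold R n}.

Definition Ck_map (k : nat) (f : M -> M) : Prop :=
  continuous f /\
  forall i j, Ck_on k (chart i @` (dom i `&` f @^-1` dom j))
                      (chart j \o f \o chart_inv i).

Definition tangent_map (f : M -> M) (x : M) :
    {linear 'rV[R]_n -> 'rV[R]_n} :=
  'd (chart (chart_at (f x)) \o f \o chart_inv (chart_at x))
     (chart (chart_at x) x).

(* Coordinates in the chart [i] of a tangent vector at [x]. *)
Definition tangent_coord (i : atlas M) (x : M) (v : tangent x) : 'rV[R]_n :=
  'd (chart i \o chart_inv (chart_at x)) (chart (chart_at x) x) v.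

Definition C1_curve (gamma : R -> M) : Prop :=
  continuous gamma /\
  forall i, Ck_on 1 (gamma @^-1` dom i) (chart i \o gamma).

Definition velocity (gamma : R -> M) (t : R) : tangent (gamma t) :=
  derive1 (chart (chart_at (gamma t)) \o gamma) t.

(* E is a vector subbundle of T_Lam M, continuous over Lam: it has continuous
   local frames [e 0, ..., e (k - 1)]. *)
Definition continuous_subbundle (Lam : set M)
    (E : forall x : M, {vspace 'rV[R]_n}) : Prop :=
  forall x, Lam x -> exists (i : atlas M) (U : set M) (k : nat)
      (e : 'I_k -> forall y : M, tangent y),
    [/\ open U, U x, U `<=` dom i,
        forall y, Lam y -> U y -> basis_of (E y) [seq e a y | a : 'I_k]
      & forall a, {within Lam `&` U, continuous
                    (fun y => tangent_coord i (x := y) (e a y))}].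

End Derivatives.

(* [metric_tensor i x] is the Gram matrix, in the chart [i], of the scalar
   product on T_xM. *)
Record riemannianMetric (R : realType) (n : nat) (M : smoothManifold R n) :=
    RiemannianMetric {
  metric_tensor : atlas M -> M -> 'M[R]_n ;
  metric_tensor_sym : forall i x, dom i x ->
    (metric_tensor i x)^T = metric_tensor i x ;
  metric_tensor_posdef : forall i x (v : 'rV[R]_n), dom i x -> v != 0 ->
    0 < (v *m metric_tensor i x *m v^T) 0 0 ;
  metric_tensor_smooth : forall i k,
    Ck_on k (chart i @` dom i) (metric_tensor i \o chart_inv i) ;
  metric_tensor_change : forall i j x, dom i x -> dom j x ->
    let J := jacobian (chart j \o chart_inv i) (chart i x) in
    metric_tensor i x = J *m metric_tensor j x *m J^T
}.

Definition tangent_norm (R : realType) (n : nat) (M : smoothManifold R n)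
    (g : riemannianMetric M) (x : M) (v : tangent x) : R :=
  Num.sqrt ((v *m metric_tensor g (chart_at x) x *m v^T) 0 0).

Definition curve_length (R : realType) (n : nat) (M : smoothManifold R n)
    (g : riemannianMetric M) (gamma : R -> M) : \bar R :=
  (\int[lebesgue_measure]_(t in `[0%R, 1%R]) (tangent_norm g (x := gamma t) (velocity gamma t))%:E)%E.

Definition curves_between (R : realType) (n : nat) (M : smoothManifold R n)
    (x y : M) : set (R -> M) :=
  [set gamma | [/\ C1_curve gamma, gamma 0 = x & gamma 1 = y]].

(* The distance [mdist] of the carrier is the Riemannian distance.  Between
   distinct connected components, where the infimum of lengths is +oo, it is
   only required to be a metric inducing the topology. *)
Record riemannianManifold (R : realType) (n : nat) := RiemannianManifold {
  smooth_part :> smoothManifold R n ;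
  riem_metric : riemannianMetric smooth_part ;
  mdist_riemannian : forall x y : smooth_part, curves_between x y !=set0 ->
    (mdist x y)%:E =
    ereal_inf [set curve_length riem_metric gamma
                  | gamma in curves_between x y]
}.

Record diffeomorphism (R : realType) (n : nat) (M : smoothManifold R n)
    (r : nat) := Diffeomorphism {
  diffeo_fun :> M -> M ;
  diffeo_inv : M -> M ;
  diffeo_funK : cancel diffeo_fun diffeo_inv ;
  diffeo_invK : cancel diffeo_inv diffeo_fun ;
  diffeo_Ck : Ck_map r diffeo_fun ;
  diffeo_inv_Ck : Ck_map r diffeo_inv
}.

Section Dynamics.
Context {R : realType} {n r : nat} {M : riemannianManifold R n}.
Variable f : diffeomorphism M r.
Local Notation finv := (diffeo_inv f).
Local Notation norm x v := (tangent_norm (riem_metric M) (x := x) v).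

Definition ziter (k : int) : M -> M :=
  match k with Posz p => iter p f | Negz p => iter p.+1 finv end.

Definition hyperbolic (Lam : set M) : Prop :=
  [/\ compact Lam, f @` Lam = Lam &
    exists Es Eu : forall x : M, {vspace 'rV[R]_n},
    [/\ continuous_subbundle Lam Es, continuous_subbundle Lam Eu,
      forall x, Lam x ->
        [/\ (Es x + Eu x = fullv)%VS, (Es x :&: Eu x = 0)%VS,
            (linfun (tangent_map f x) @: Es x)%VS = Es (f x)
          & (linfun (tangent_map f x) @: Eu x)%VS = Eu (f x)]
    & exists c lam : R, [/\ 0 < c, 0 < lam < 1,
        forall p x v, Lam x -> v \in Es x ->
          norm (iter p f x) (tangent_map (iter p f) x v)
            <= c * lam ^+ p * norm x v
      & forall p x v, Lam x -> v \in Eu x ->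
          norm (iter p finv x) (tangent_map (iter p finv) x v)
            <= c * lam ^+ p * norm x v]]].

Definition nonwandering : set M :=
  [set x | forall U, nbhs x U ->
     exists2 p : nat, (0 < p)%N & (iter p f @` U) `&` U !=set0].

Definition periodic_points : set M :=
  [set x | exists2 p : nat, (0 < p)%N & iter p f x = x].

Definition axiom_A : Prop :=
  hyperbolic nonwandering /\
  nonwandering `<=` closure (nonwandering `&` periodic_points).

Definition transitive_on (h : M -> M) (X : set M) : Prop :=
  forall U V : set M, open U -> open V ->
    X `&` U !=set0 -> X `&` V !=set0 ->
    exists2 p : nat, (0 < p)%N & (iter p h @` (X `&` U)) `&` (X `&` V) !=set0.

Definition mixing_on (h : M -> M) (X : set M) : Prop :=
  forall U V : set M, open U -> open V ->
    X `&` U !=set0 -> X `&` V !=set0 ->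
    exists N : nat, forall p : nat, (N <= p)%N ->
      (iter p h @` (X `&` U)) `&` (X `&` V) !=set0.

Definition cyclic_mixing (Lam : set M) : Prop :=
  exists (p : nat) (X : nat -> set M),
    [/\ (0 < p)%N, \bigcup_(j in `I_p) X j = Lam, trivIset `I_p X
      & forall j, (j < p)%N ->
          [/\ closed (X j), f @` X j = X (j.+1 %% p)%N
            & mixing_on (iter p f) (X j)]].

Definition spectral_decomposition (k : nat) (B : 'I_k -> set M) : Prop :=
  [/\ \bigcup_i B i = nonwandering, trivIset setT B
    & forall i, [/\ B i !=set0, closed (B i), f @` B i = B i,
                    transitive_on f (B i) & cyclic_mixing (B i)]].

Definition basic_set (Lam : set M) : Prop :=
  exists (k : nat) (B : 'I_k -> set M),
    spectral_decomposition B /\ exists i, B i = Lam.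

Section MarkovPartitions.
Variables (Om : set M) (eps delta0 : R).

Definition Ws (x : M) : set M :=
  [set y | forall p : nat, mdist (iter p f x) (iter p f y) <= eps].

Definition Wu (x : M) : set M :=
  [set y | forall p : nat, mdist (iter p finv x) (iter p finv y) <= eps].

Definition local_product_structure : Prop :=
  forall x y, Om x -> Om y -> mdist x y < delta0 ->
    exists2 z, Om z & Ws x `&` Wu y = [set z].

(* [x, y]; the default value [x] is irrelevant when Ws x `&` Wu y is a
   singleton. *)
Definition bracket (x y : M) : M := xget x (Ws x `&` Wu y).

Definition diam (Q : set M) : \bar R :=
  ereal_sup [set (mdist x y)%:E | x in Q & y in Q].

Definition rel_int (S A : set M) : set M :=
  [set x | S x /\ within S (nbhs x) A].

Definition rectangle (Q : set M) : Prop :=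
  [/\ Q `<=` Om, (diam Q < delta0%:E)%E
    & forall x y, Q x -> Q y -> Q (bracket x y)].

Definition proper_rectangle (Q : set M) : Prop :=
  [/\ rectangle Q, closed Q & Q = closure (rel_int Om Q)].

Definition Ws_in (x : M) (Q : set M) : set M := Ws x `&` Q.
Definition Wu_in (x : M) (Q : set M) : set M := Wu x `&` Q.

Definition markov_partition (m : nat) (Q : 'I_m -> set M) : Prop :=
  [/\ forall i, proper_rectangle (Q i) /\ (diam (Q i) < eps%:E)%E,
      \bigcup_i Q i = Om,
      forall i j, i != j -> rel_int Om (Q i) `&` rel_int Om (Q j) = set0
    & forall i j x, rel_int Om (Q i) x -> rel_int Om (Q j) (f x) ->
        Wu_in (f x) (Q j) `<=` f @` Wu_in x (Q i) /\
        f @` Ws_in x (Q i) `<=` Ws_in (f x) (Q j)].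

Definition transition_matrix (m : nat) (Q : 'I_m -> set M) : 'M[nat]_m :=
  \matrix_(i, j)
    (if `[< rel_int Om (Q i) `&` f @^-1` rel_int Om (Q j) !=set0 >]
     then 1%N else 0%N).

Definition stable_boundary (Q : set M) : set M :=
  [set x | Q x /\ ~ rel_int (Wu x `&` Om) (Wu_in x Q) x].

Definition unstable_boundary (Q : set M) : set M :=
  [set x | Q x /\ ~ rel_int (Ws x `&` Om) (Ws_in x Q) x].

Definition good_set (m : nat) (Q : 'I_m -> set M) : set M :=
  Om `\` \bigcup_(k : int) (ziter k @`
           (\bigcup_j stable_boundary (Q j) `|` \bigcup_j unstable_boundary (Q j))).

End MarkovPartitions.

Definition is_itinerary (m : nat) (Q : 'I_m -> set M) (x : M)
    (a : int -> 'I_m) : Prop :=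
  forall i : int, Q (a i) (ziter i x).

End Dynamics.

Definition subshift (m : nat) (A : 'M[nat]_m) : set (int -> 'I_m) :=
  [set a | forall i : int, A (a i) (a (i + 1)) = 1%N].

Definition shift_map (m : nat) (a : int -> 'I_m) : int -> 'I_m :=
  fun i => a (i + 1).

Definition differ_at (m : nat) (a b : int -> 'I_m) : pred nat :=
  fun p => `[< exists2 i : int, `|i|%N = p & a i <> b i >].

Definition shift_dist (R : realType) (m : nat) (a b : int -> 'I_m) : R :=
  match pselect (exists p, differ_at a b p) with
  | left h => 2^-1 ^+ ex_minn h
  | right _ => 0
  end.

Definition continuous_on_subshift (R : realType) (M : metricType R) (m : nat)
    (A : 'M[nat]_m) (pi : (int -> 'I_m) -> M) : Prop :=
  forall a, subshift A a -> forall e : R, 0 < e ->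
    exists2 d : R, 0 < d &
      forall b, subshift A b -> shift_dist R a b < d -> mdist (pi a) (pi b) < e.

(* Main.v *)
Require Import Defs.
From mathcomp Require Import all_boot all_order all_algebra.
From mathcomp Require Import all_classical all_reals all_analysis.
From mathcomp Require Import zify lra.

Set Implicit Arguments.
Unset Strict Implicit.
Unset Printing Implicit Defensive.

Import Order.TTheory GRing.Theory Num.Theory.
Import numFieldNormedType.Exports.

Local Open Scope classical_set_scope.
Local Open Scope ring_scope.

(** Expansivity.  For [x] in [Om] the local product structure at scale [E] says
    that [Ws x `&` Wu x] is a singleton, so it is [[set x]]: a point whose orbit
    stays [E]-close to that of [x] for all times is [x].  If such a structure
    exists at some scale [E], take [eps0 := E / 3]; then every [eps <= eps0]
    comes with expansivity at scale [3 * eps], which leaves room for composing a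
    few [eps]-closeness relations.  If there is no such scale, every [eps0]
    will do.

    Points from sequences ([admissible_intersection]).  The Markov property is
    given only at points [x] interior to [Q i] with [f x] interior to [Q j].
    Brackets transport its unstable half to all of the stable slice of [x]
    ([markov_unstable]).  An induction along an admissible word then produces a
    point of the last rectangle whose whole unstable slice has the prescribed
    past, and compactness passes to two-sided sequences.  Expansivity makes the
    point unique, hence defines [pi]; compactness also gives the continuity of
    [pi] ([itinerary_continuous]).

    Sequences from points ([admissible_itinerary_exists]).  Since each [Q i] is
    the closure of its interior, the points near a given [x] whose orbit meets
    only interiors during a given finite time are dense.  An ultrafilter
    converging to [x] and containing all these sets of points chooses, at each
    time, one rectangle; consecutive choices are realised by a common point, so
    the resulting sequence is admissible, and [x] follows it because rectangles
    are closed.  Hence [pi] is onto.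

    The good set ([good_set_interior]).  The bracket is continuous at the
    diagonal ([shadow_near]), so a point of a rectangle that lies on neither
    boundary is an interior point.  The orbit of a point of [Y] therefore meets
    only interiors, which are pairwise disjoint, and its itinerary is unique. *)

(** * Metric and symbolic preliminaries *)

(** The form in which compactness is used below: every closed condition that
    holds eventually along [u] holds at one and the same point. *)
Lemma compact_seq_cluster (T : topologicalType) (u : nat -> T) :
  compact [set: T] ->
  exists x, forall C, closed C ->
    (exists N0 : nat, forall N, (N0 <= N)%N -> C (u N)) -> C x.
Proof.
move=> /(_ (u @ \oo) _ filterT)[x [_ ux]]; exists x => C Ccl [N0 uC].
apply: Ccl => B xB; apply: ux xB.
by exists N0.
Qed.

Lemma closed_mdist_le (R : realType) (T : metricType R) (c : T) (e : R) :
  closed [set y | mdist c y <= e].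
Proof.
move=> y yC /=; apply/ler_addgt0Pr => h h0.
have [z [/= cz]] := yC _ (nbhsx_ballx y _ h0).
rewrite ballEmdist/= => yz.
by rewrite (le_trans (metric_triangle _ z _))// lerD// metric_sym ltW.
Qed.

Lemma nbhs_mdist (R : realType) (T : metricType R) (x : T) (V : set T) :
  nbhs x V -> exists2 e : R, 0 < e & forall y, mdist x y < e -> V y.
Proof.
move=> /nbhs_ballP[e /= e0 eV]; exists e => // y xy; apply: eV.
by rewrite ballEmdist.
Qed.

(** The orientation of the distances in the premises is the one produced by
    stable and unstable sets, whose centre comes first. *)
Lemma mdist_common_neighbor (R : realType) (T : metricType R) (x y z : T)
    (d e : R) : mdist y x <= d -> mdist y z <= e -> mdist x z <= d + e.
Proof.
move=> yx yz; apply: le_trans (metric_triangle _ y _) _.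
by rewrite lerD// metric_sym.
Qed.

Lemma shift_dist_agree (R : realType) (m : nat) (a b : int -> 'I_m) (N : nat) :
  shift_dist R a b < 2^-1 ^+ N -> forall k : int, (`|k| <= N)%N -> a k = b k.
Proof.
rewrite /shift_dist; case: pselect => [h|h] abN k kN; last first.
  by apply: contrapT => ab; apply: h; exists `|k|%N; apply/asboolP; exists k.
apply: contrapT => ab; move: abN; case: ex_minnP => p _ pmin.
rewrite ltr_iXn2l; [|lra..] => Np.
have : (p <= `|k|)%N by apply: pmin; apply/asboolP; exists k.
by rewrite leqNgt (leq_ltn_trans kN).
Qed.

(** * Orbits and expansivity *)

Section Orbits.
Context {R : realType} {n r : nat} {M : riemannianManifold R n}.
Variable f : diffeomorphism M r.

Lemma ziter_add1 k x : ziter f (k + 1) x = f (ziter f k x).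
Proof.
case: k => [p|[|p]]; first by rewrite -PoszD addn1.
  by rewrite /= diffeo_invK.
have -> : Negz p.+1 + 1 = Negz p by lia.
by rewrite [RHS]/= diffeo_invK.
Qed.

Lemma ziterD j k x : ziter f (j + k) x = ziter f j (ziter f k x).
Proof.
elim: j => [|j IH|j IH]; first by rewrite add0r.
  rewrite (_ : (j.+1 : int) + k = j%:Z + k + 1); last by lia.
  by rewrite ziter_add1 IH.
apply: (can_inj (diffeo_funK f)); rewrite -!ziter_add1.
have -> : - (j.+1 : int) + k + 1 = - j%:Z + k by lia.
by have -> : - (j.+1 : int) + 1 = - j%:Z by lia.
Qed.

Lemma ziterK k : cancel (ziter f k) (ziter f (- k)).
Proof. by move=> x; rewrite -ziterD addNr. Qed.

Lemma ziterKV k : cancel (ziter f (- k)) (ziter f k).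
Proof. by move=> x; rewrite -ziterD addrN. Qed.

Lemma ziter_continuous k : continuous (ziter f k).
Proof.
have iterc (g : M -> M) p : continuous g -> continuous (iter p g).
  move=> gc; elim: p => [|p IH] x /=; first exact: cvg_id.
  by apply: (@continuous_comp _ _ _ (iter p g) g); [exact: IH|exact: gc].
case: k => p; first exact/iterc/(diffeo_Ck f).1.
exact/iterc/(diffeo_inv_Ck f).1.
Qed.

Lemma closed_ziter k (C : set M) : closed C -> closed (ziter f k @^-1` C).
Proof. by apply: closed_comp => x _; exact: ziter_continuous. Qed.

Lemma open_ziter k (U : set M) : open U -> open (ziter f k @^-1` U).
Proof. by apply: open_comp => x _; exact: ziter_continuous. Qed.

Lemma ziter_invariant (Om : set M) k x :
  f @` Om = Om -> Om x -> Om (ziter f k x).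
Proof.
move=> fOm Omx.
have Omf y : Om y -> Om (f y) by move=> Omy; rewrite -fOm; exists y.
have Omg y : Om y -> Om (diffeo_inv f y).
  by rewrite -{1}fOm => -[z Omz <-]; rewrite diffeo_funK.
by case: k => p /=; [elim: p => //= p /Omf|apply: (Omg); elim: p => //= p /Omg].
Qed.

(** Stable and unstable sets as conditions on the same two-sided orbit, so that
    they combine with expansivity. *)
Lemma WsP eps x y : Ws f eps x y <->
  forall k : int, 0 <= k -> mdist (ziter f k x) (ziter f k y) <= eps.
Proof.
split=> [xy [p _|//]|xy p]; first exact: xy.
exact: (xy (Posz p)).
Qed.

Lemma WuP eps x y : Wu f eps x y <->
  forall k : int, k <= 0 -> mdist (ziter f k x) (ziter f k y) <= eps.
Proof.
split=> [xy [[|//] _|p _]|xy [|p]]; [exact: (xy 0%N)|exact: (xy p.+1)|..].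
  exact: (xy 0).
exact: (xy (Negz p)).
Qed.

Definition expansive_on (Om : set M) (E : R) : Prop :=
  forall x y, Om x -> (forall k, mdist (ziter f k x) (ziter f k y) <= E) ->
  x = y.

Lemma expansive_onS Om E E' :
  E' <= E -> expansive_on Om E -> expansive_on Om E'.
Proof.
by move=> E'E Eexp x y Omx xy; apply: Eexp => // k; apply: le_trans E'E.
Qed.

(** A point shadowing [x] at all times lies in [Ws x `&` Wu x], as does [x]
    itself, and that intersection is a singleton. *)
Lemma local_product_structure_expansive Om eps delta0 :
  0 < delta0 -> local_product_structure f Om eps delta0 ->
  expansive_on Om eps.
Proof.
move=> d0 lps x y Omx xy; have eps0 : 0 <= eps.
  by rewrite (le_trans _ (xy 0))// mdist_ge0.
have [|z _ Wz] := lps x x Omx Omx; first by rewrite mdistxx.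
have Wx : (Ws f eps x `&` Wu f eps x) x by split=> p; rewrite mdistxx.
have Wy : (Ws f eps x `&` Wu f eps x) y by split; [apply/WsP|apply/WuP].
by move: Wx Wy; rewrite Wz => -> ->.
Qed.

(** Continuity of the bracket at the diagonal, in both of its arguments: [z] may
    be [[x, y]] or [[y, x]].  If [y] tends to [x], a limit of such points [z]
    has an orbit [E]-close to that of [x] at all times, whichever alternative
    holds at each time, so it is [x] by expansivity. *)
Lemma shadow_near Om E x (V : set M) : compact [set: M] ->
  expansive_on Om E -> Om x -> nbhs x V ->
  exists2 rho : R, 0 < rho & forall y z, mdist x y < rho ->
    (forall k, mdist (ziter f k x) (ziter f k z) <= E \/
               mdist (ziter f k y) (ziter f k z) <= E) -> V z.
Proof.
move=> Mcpt Eexp Omx xV; apply: contrapT => noV.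
have bad (N : nat) : exists yz : M * M, [/\ mdist x yz.1 < N.+1%:R^-1,
    ~ V yz.2 & forall k, mdist (ziter f k x) (ziter f k yz.2) <= E \/
                       mdist (ziter f k yz.1) (ziter f k yz.2) <= E].
  apply: contrapT => noN; apply: noV; exists N.+1%:R^-1 => // y z xy yz.
  by apply: contrapT => Vz; apply: noN; exists (y, z).
have [u uP] := choice bad.
have [w wP] := compact_seq_cluster (fun N => (u N).2) Mcpt.
suff xw : x = w.
  (* [w], as a limit of points outside [V], is not interior to [V]; [x] is. *)
  suff : ~ V° w by apply; rewrite -xw; exact: xV.
  apply: (wP (~` V°)); first exact/open_closedC/open_interior.
  by exists 0%N => N _ /interior_subset; case: (uP N).
apply: Eexp Omx _ => k; apply/ler_addgt0Pr => h h0.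
have /nbhs_mdist[e e0 eP] : nbhs x (ziter f k @^-1` ball (ziter f k x) h).
  by apply: (@ziter_continuous k x); exact: nbhsx_ballx.
apply: (wP (ziter f k @^-1` [set z | mdist (ziter f k x) z <= E + h])).
  by apply: closed_ziter; exact: closed_mdist_le.
have [N0 N0e] : exists N0 : nat, N0.+1%:R^-1 < e.
  by exists (Num.truncn e^-1); rewrite invf_plt ?posrE//; exact: truncnS_gt.
exists N0 => N N0N /=; have [xu _ /(_ k)[|yz]] := uP N; first lra.
have xy : mdist (ziter f k x) (ziter f k (u N).1) < h.
  have := eP (u N).1; rewrite /= ballEmdist; apply.
  rewrite (lt_trans xu)// (le_lt_trans _ N0e)// lef_pV2 ?posrE//.
  by rewrite ler_nat ltnS.
by have := metric_triangle (ziter f k x) (ziter f k (u N).1)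
  (ziter f k (u N).2); lra.
Qed.

End Orbits.

(** * Brackets and rectangles *)

Section Rectangles.
Context {R : realType} {n r : nat} {M : riemannianManifold R n}.
Variables (f : diffeomorphism M r) (Om : set M) (eps delta0 : R).
Hypothesis lps : local_product_structure f Om eps delta0.

Lemma mdist_diam (Q : set M) x y e :
  (diam Q < e%:E)%E -> Q x -> Q y -> mdist x y < e.
Proof.
move=> Qe Qx Qy; rewrite -lte_fin; apply: le_lt_trans Qe.
by apply: ereal_sup_ubound; exists x => //; exists y.
Qed.

Lemma bracketP x y : Om x -> Om y -> mdist x y < delta0 ->
  [/\ Om (bracket f eps x y), Ws f eps x (bracket f eps x y)
    & Wu f eps y (bracket f eps x y)].
Proof.
move=> Omx Omy xy; have [z Omz Wz] := lps Omx Omy xy.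
have : (Ws f eps x `&` Wu f eps y) (bracket f eps x y).
  by apply: (@xgetPex _ x (Ws f eps x `&` Wu f eps y)); exists z; rewrite Wz.
by move=> /[dup] -[Wsb Wub]; rewrite Wz => bz; split=> //; rewrite bz.
Qed.

Lemma bracket_unique x y z : Om x -> Om y -> mdist x y < delta0 ->
  Ws f eps x z -> Wu f eps y z -> z = bracket f eps x y.
Proof.
move=> Omx Omy xy xz yz; have [w _ Ww] := lps Omx Omy xy.
have [_ xb yb] := bracketP Omx Omy xy.
have -> : z = w by have : (Ws f eps x `&` Wu f eps y) z by []; rewrite Ww.
have : (Ws f eps x `&` Wu f eps y) (bracket f eps x y) by [].
by rewrite Ww.
Qed.

Lemma rectangle_bracket Q x y : rectangle f Om eps delta0 Q -> Q x -> Q y ->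
  [/\ Q (bracket f eps x y), Ws f eps x (bracket f eps x y)
    & Wu f eps y (bracket f eps x y)].
Proof.
move=> [QOm Qd Qb] Qx Qy.
have [_ xb yb] := bracketP (QOm _ Qx) (QOm _ Qy) (mdist_diam Qd Qx Qy).
by split=> //; exact: Qb.
Qed.

(** Unstable closeness inside a rectangle improves by itself from [2 * eps] to
    [eps]: the point [[q, p]] is [eps]-close to [q] in the future and
    [3 * eps]-close in the past, hence equal to [q].  This is what makes the
    unstable relation transitive within a rectangle. *)
Lemma Wu_rectangle Q p q : expansive_on f Om (3 * eps) ->
  rectangle f Om eps delta0 Q -> Q p -> Q q ->
  (forall k : int, k <= 0 -> mdist (ziter f k p) (ziter f k q) <= 2 * eps) ->
  Wu f eps p q.
Proof.
move=> Oexp rQ Qp Qq pq.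
have [Qb /WsP qb /WuP pb] := rectangle_bracket rQ Qq Qp.
have -> // : q = bracket f eps q p; last exact/WuP.
apply: Oexp => [|k]; first by case: rQ => /(_ _ Qq).
have eps0 : 0 <= eps by rewrite (le_trans _ (qb 0 _))// mdist_ge0.
have [k0|/ltW k0] := lerP 0 k; first by have := qb _ k0; lra.
have := mdist_common_neighbor (pq _ k0) (pb _ k0); lra.
Qed.

(** A point [y] of [Om] near [x] is recovered from its two coordinates as the
    bracket of [[y, x]], which lies in the unstable slice of [x], and [[x, y]],
    which lies in the stable slice.  Both are near [x], hence in [Q] as [x] is
    interior to its two slices, and [Q] is closed under brackets. *)
Lemma rel_int_of_not_boundary Q x : compact [set: M] -> 0 < delta0 ->
  rectangle f Om eps delta0 Q -> Q x ->
  ~ stable_boundary f Om eps Q x -> ~ unstable_boundary f Om eps Q x ->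
  rel_int Om Q x.
Proof.
move=> Mcpt delta0_gt0 [QOm Qd Qb] Qx nsx nux; have Omx := QOm _ Qx.
have Oexp := local_product_structure_expansive delta0_gt0 lps.
have [_ Vu] : rel_int (Wu f eps x `&` Om) (Wu_in f eps x Q) x.
  by apply: contrapT => h; exact: nsx.
have [_ Vs] : rel_int (Ws f eps x `&` Om) (Ws_in f eps x Q) x.
  by apply: contrapT => h; exact: nux.
have /(shadow_near Mcpt Oexp Omx)[rho rho0 rhoP] : nbhs x
    [set z | ((Wu f eps x `&` Om) z -> Wu_in f eps x Q z) /\
             ((Ws f eps x `&` Om) z -> Ws_in f eps x Q z)].
  by apply: filterI; [exact: Vu|exact: Vs].
split=> //; apply/nbhs_ballP.
exists (Num.min rho delta0) => /=; first by rewrite lt_min rho0.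
move=> y; rewrite ballEmdist /= lt_min => /andP[xrho xy] Omy.
have yx : mdist y x < delta0 by rewrite metric_sym.
have [Omp xp yp] := bracketP Omx Omy xy.
have [Omq yq xq] := bracketP Omy Omx yx.
have Qp : Q (bracket f eps x y).
  case: (rhoP y (bracket f eps x y) xrho) => [k|_ /(_ (conj xp Omp))[]//].
  have [k0|/ltW k0] := lerP 0 k; first by left; move/WsP : xp; apply.
  by right; move/WuP : yp; apply.
have Qq : Q (bracket f eps y x).
  case: (rhoP y (bracket f eps y x) xrho) => [k|/(_ (conj xq Omq))[]//].
  have [k0|/ltW k0] := lerP 0 k; first by right; move/WsP : yq; apply.
  by left; move/WuP : xq; apply.
have -> : y = bracket f eps (bracket f eps y x) (bracket f eps x y).
  apply: bracket_unique => //; first exact: mdist_diam Qd Qq Qp.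
    by move=> k; rewrite metric_sym; exact: yq.
  by move=> k; rewrite metric_sym; exact: yp.
exact: Qb.
Qed.

End Rectangles.

Lemma rel_int_open (R : realType) (n : nat) (M : riemannianManifold R n)
    (Om Q : set M) x : rel_int Om Q x ->
  exists U, [/\ open U, U x & forall y, U y -> Om y -> rel_int Om Q y].
Proof.
move=> [Omx]; rewrite /within /= nbhsE => -[U [Uop Ux] UQ].
exists U; split=> // y Uy Omy; split=> //; rewrite /within /= nbhsE.
by exists U.
Qed.

(** * Admissible sequences and the points that follow them *)

Section Coding.
Context {R : realType} {n r : nat} {M : riemannianManifold R n}.
Variables (f : diffeomorphism M r) (Om : set M) (eps delta0 : R).
Variables (m : nat) (Q : 'I_m -> set M).
Hypothesis Mcpt : compact [set: M].
Hypothesis fOm : f @` Om = Om.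
Hypothesis eps_gt0 : 0 < eps.
Hypothesis Oexp : expansive_on f Om (3 * eps).
Hypothesis lps : local_product_structure f Om eps delta0.
Hypothesis markov : markov_partition f Om eps delta0 Q.

Local Notation A := (transition_matrix f Om Q).

Let Qrect i : rectangle f Om eps delta0 (Q i).
Proof. by case: markov => /(_ i)[[]]. Qed.

Let Qclosed i : closed (Q i).
Proof. by case: markov => /(_ i)[[]]. Qed.

Let QOm i x : Q i x -> Om x.
Proof. by case: (Qrect i) => QO _ _; exact: QO. Qed.

Let rel_int_Q i x : rel_int Om (Q i) x -> Q i x.
Proof. by case=> Omx /nbhs_singleton; apply. Qed.

Lemma transitionP i j : A i j = 1%N <->
  exists2 x, rel_int Om (Q i) x & rel_int Om (Q j) (f x).
Proof.
rewrite mxE; case: asboolP => [[x [xi xj]]|h]; split=> //.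
  by exists x.
by case=> x xi xj; case: h; exists x.
Qed.

(** The inclusion [Wu (f x) (Q j) `<=` f @` Wu x (Q i)] carries over from [x] to
    each point [y] of its stable slice: project [z] to the unstable slice of
    [f x], pull it back to [v] by the inclusion known there, and project [v] to
    the unstable slice of [y].  The image of the resulting point has an orbit
    [2 * eps]-close to that of [z], hence is [z]. *)
Lemma markov_unstable i j x y z : rel_int Om (Q i) x ->
  rel_int Om (Q j) (f x) -> Q i y -> Ws f eps x y -> Q j z ->
  Wu f eps (f y) z -> Q i (diffeo_inv f z) /\ Wu f eps y (diffeo_inv f z).
Proof.
move=> xi fxj Qy xy Qz yz.
have [_ _ _ /(_ i j x xi fxj)[mu ms]] := markov.
have [Qw zw fxw] := rectangle_bracket lps (Qrect j) Qz (rel_int_Q fxj).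
have [v [_ Qv] vw] := mu _ (conj fxw Qw).
have [Qu vu yu] := rectangle_bracket lps (Qrect i) Qv Qy.
suff <- : bracket f eps v y = diffeo_inv f z by [].
apply: (can_inj (diffeo_funK f)); rewrite diffeo_invK.
apply: Oexp => [|k].
  by rewrite -fOm; exists (bracket f eps v y) => //; exact: QOm Qu.
have le3 : eps + eps <= 3 * eps by move: eps_gt0; lra.
(* The common companion is [f v] in the future and [f y] in the past. *)
apply: le_trans le3; have [k0|k0] := lerP 0 k.
  apply: (mdist_common_neighbor (y := ziter f k (f v))).
    by move/WsP : vu => /(_ (k + 1)); rewrite !ziterD; apply; lia.
  by rewrite vw metric_sym; move/WsP : zw; apply.
apply: (mdist_common_neighbor (y := ziter f k (f y))).
  by move/WuP : yu => /(_ (k + 1)); rewrite !ziterD; apply; lia.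
by move/WuP : yz; apply; exact: ltW.
Qed.

(** The realisation of a word of length [N + 1], strengthened to the whole
    unstable slice of the last rectangle so that the next step may move within
    that slice: the new point is [f [x, y]], with [x] a witness of the
    transition, and its unstable slice pulls back into that of [y]. *)
Lemma admissible_word_realized (a : int -> 'I_m) (s : int) (N : nat) :
  subshift A a ->
  exists2 y, Q (a (s + N%:Z)) y &
    forall z, Q (a (s + N%:Z)) z -> Wu f eps y z ->
    forall j : nat, (j <= N)%N ->
      Q (a (s + N%:Z - j%:Z)) (ziter f (- j%:Z) z).
Proof.
move=> aA; elim: N => [|N [y Qy IH]].
  have [x xi _] := (transitionP _ _).1 (aA (s + 0%:Z)).
  exists x; first exact: rel_int_Q.
  by move=> z Qz _ [|//] _; rewrite subr0.
have e : s + N.+1%:Z = s + N%:Z + 1 by lia.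
rewrite e; have [x xi xj] := (transitionP _ _).1 (aA (s + N%:Z)).
have [Qb xb yb] := rectangle_bracket lps (Qrect _) (rel_int_Q xi) Qy.
have [_ _ _ /(_ _ _ x xi xj)[_ ms]] := markov.
have [] : Ws_in f eps (f x) (Q (a (s + N%:Z + 1))) (f (bracket f eps x y)).
  by apply: ms; exists (bracket f eps x y).
move=> _ Qfb; exists (f (bracket f eps x y)) => // z Qz bz.
have [Qgz bgz] := markov_unstable xi xj Qb xb Qz bz.
have ygz : Wu f eps y (diffeo_inv f z).
  apply: (Wu_rectangle lps Oexp (Qrect _) Qy Qgz) => k k0.
  rewrite mulr_natl mulr2n.
  apply: (mdist_common_neighbor (y := ziter f k (bracket f eps x y))).
    by rewrite metric_sym; move/WuP : yb; apply.
  by move/WuP : bgz; apply.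
case=> [|j] jN; first by rewrite subr0.
have := IH _ Qgz ygz j jN.
have -> : s + N%:Z + 1 - j.+1%:Z = s + N%:Z - j%:Z by lia.
have -> : - j.+1%:Z = - j%:Z + (- 1) by lia.
by rewrite ziterD.
Qed.

Lemma admissible_intersection (a : int -> 'I_m) : subshift A a ->
  exists x, is_itinerary f Q x a.
Proof.
move=> aA.
have fin (N : nat) : exists x, forall k, (`|k| <= N)%N ->
    Q (a k) (ziter f k x).
  have [y Qy yP] := admissible_word_realized (- N%:Z) (N + N) aA.
  (* The word occupies the times from [- N] to [N] and [y] sits at its end. *)
  exists (ziter f (- N%:Z) y) => k kN.
  have yy : Wu f eps y y by move=> p; rewrite mdistxx ltW.
  have := yP y Qy yy `|N%:Z - k|%N ltac:(lia).
  rewrite -ziterD.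
  have -> : - N%:Z + (N + N)%N%:Z - `|N%:Z - k|%N%:Z = k by lia.
  by have -> : - `|N%:Z - k|%N%:Z = k + (- N%:Z) by lia.
have [u uP] := choice fin; have [x xP] := compact_seq_cluster u Mcpt.
exists x => k; apply: (xP (ziter f k @^-1` Q (a k))).
  exact: closed_ziter.
by exists `|k|%N => N kN; exact: uP.
Qed.

Lemma itinerary_unique_point (a : int -> 'I_m) x y :
  is_itinerary f Q x a -> is_itinerary f Q y a ->
  x = y.
Proof.
move=> xa ya; apply: Oexp => [|k]; first exact: QOm (xa 0).
have [/(_ (a k))[_ Qd] _ _ _] := markov.
by have := mdist_diam Qd (xa k) (ya k); move: eps_gt0; lra.
Qed.

(** Points [y] whose itineraries agree with [a] on longer and longer windows can
    only accumulate at points with itinerary [a], and [x] is the only one. *)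
Lemma itinerary_continuous (a : int -> 'I_m) x (e : R) :
  is_itinerary f Q x a -> 0 < e ->
  exists2 d : R, 0 < d & forall b y, is_itinerary f Q y b ->
    shift_dist R a b < d -> mdist x y < e.
Proof.
move=> xa e0; apply: contrapT => nod.
have bad (N : nat) : exists y, ~ mdist x y < e /\
    forall k, (`|k| <= N)%N -> Q (a k) (ziter f k y).
  apply: contrapT => noN; apply: nod; exists (2^-1 ^+ N) => [|b y yb ab].
    by rewrite exprn_gt0.
  apply: contrapT => xy; apply: noN; exists y; split=> // k kN.
  by rewrite (shift_dist_agree ab kN).
have [u uP] := choice bad; have [w wP] := compact_seq_cluster u Mcpt.
have xw : x = w.
  apply: (itinerary_unique_point xa) => k.
  apply: (wP (ziter f k @^-1` Q (a k))); first exact: closed_ziter.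
  by exists `|k|%N => N kN; case: (uP N) => _; apply.
suff : ~ (ball x e)° w by apply; rewrite -xw; exact: nbhsx_ballx.
apply: (wP (~` (ball x e)°)); first exact/open_closedC/open_interior.
by exists 0%N => N _ /interior_subset; rewrite ballEmdist /=; case: (uP N).
Qed.

(** * Itineraries of points *)

Definition interiors : set M := \bigcup_i rel_int Om (Q i).

Lemma interiors_dense (U : set M) x : open U -> U x -> Om x ->
  (U `&` interiors) !=set0.
Proof.
move=> Uop Ux; have [QP QOmE _ _] := markov.
rewrite -QOmE => -[i _ Qx]; have [[_ _ Qcl] _] := QP i.
move: Qx; rewrite Qcl => /(_ U (open_nbhs_nbhs (conj Uop Ux)))[y [yi Uy]].
by exists y; split=> //; exists i.
Qed.

(** A finite intersection of dense open subsets of [Om], the preimages of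
    [interiors] at the times in [l], is dense.  The proof carries along a whole
    open piece of that intersection, which each new time shrinks. *)
Lemma interiors_orbit_dense (l : seq int) (U : set M) x :
  open U -> U x -> Om x ->
  exists2 y, U y & Om y /\ forall k, k \in l -> interiors (ziter f k y).
Proof.
move=> Uop Ux Omx.
suff [V [y [Vop VU Vy Omy VP]]] : exists V y, [/\ open V, V `<=` U, V y, Om y
    & forall z k, V z -> Om z -> k \in l -> interiors (ziter f k z)].
  by exists y; [exact: VU|split=> // k kl; exact: VP].
elim: l => [|k l [V [y [Vop VU Vy Omy VP]]]]; first by exists U, x; split.
have Vkop : open (ziter f (- k) @^-1` V) by apply: open_ziter.
have Vky : (ziter f (- k) @^-1` V) (ziter f k y) by rewrite /= ziterK.
have [g [Vg [i _ gi]]] :=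
  interiors_dense Vkop Vky (ziter_invariant k fOm Omy).
have [W [Wop Wg WP]] := rel_int_open gi.
exists (V `&` ziter f k @^-1` W), (ziter f (- k) g); split.
- by apply: openI => //; exact: open_ziter.
- by move=> z [/VU].
- by split=> //=; rewrite ziterKV.
- by apply: ziter_invariant => //; case: gi.
- move=> z j [Vz Wz] Omz; rewrite inE => /orP[/eqP ->|jl]; last exact: VP.
  by exists i => //; apply: WP => //; exact: ziter_invariant.
Qed.

(** The itinerary of [x] is read off from generic nearby points.  Since an
    ultrafilter takes the limit of their itineraries at all times together, any
    two consecutive symbols of the limit are those of an actual orbit through
    interiors; a separate choice of a rectangle containing each [f^k x] would
    not ensure admissibility. *)
Lemma admissible_itinerary_exists x : Om x ->
  exists2 a, subshift A a & is_itinerary f Q x a.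
Proof.
move=> Omx.
pose D := [set Ul : set M * seq int | open Ul.1 /\ Ul.1 x].
pose B (Ul : set M * seq int) :=
  [set y | [/\ Ul.1 y, Om y & forall k, k \in Ul.2 -> interiors (ziter f k y)]].
have FF : Filter (filter_from D B).
  apply: filter_from_filter.
    by exists (setT, [::]); split => //; exact: openT.
  move=> [U l] [V l'] [/= Uop Ux] [/= Vop Vx].
  exists (U `&` V, l ++ l'); first by split=> //=; exact: openI.
  move=> y [/= [Uy Vy] Omy yP].
  by split; split=> //= k kl; apply: yP; rewrite mem_cat kl ?orbT.
have PF : ProperFilter (filter_from D B).
  apply: filter_from_proper => -[U l] [/= Uop Ux].
  have [y Uy [Omy yP]] := interiors_orbit_dense l Uop Ux Omx.
  by exists y.
have [G [GU FG]] := ultraFilterLemma PF.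
have Gi k : exists i, G [set y | rel_int Om (Q i) (ziter f k y)].
  apply: contrapT => noi.
  have Gni : \forall y \near G, forall i, ~ rel_int Om (Q i) (ziter f k y).
    apply: filter_forall => i.
    have [Gi|//] :=
      in_ultra_setVsetC [set y | rel_int Om (Q i) (ziter f k y)] GU.
    by case: noi; exists i.
  have Gk : G [set y | interiors (ziter f k y)].
    apply: FG; exists (setT, [:: k]); first by split=> //; exact: openT.
    by move=> y [_ _]; apply; rewrite mem_head.
  by have [y [/= ni [i _ yi]]] := filter_ex (filterI Gni Gk); exact: (ni i).
have [a aP] := choice Gi.
exists a => k.
  have [y [/= yk]] := filter_ex (filterI (aP k) (aP (k + 1))).
  rewrite ziter_add1 => yk1.
  by apply/transitionP; exists (ziter f k y).
apply: contrapT => nQ.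
have Gn : G (ziter f k @^-1` (~` Q (a k))).
  apply: FG; exists (ziter f k @^-1` (~` Q (a k)), [::]).
    by split=> //=; apply: open_ziter; exact: closed_openC.
  by move=> y [].
by have [y [/= /rel_int_Q]] := filter_ex (filterI (aP k) Gn).
Qed.

Lemma good_set_interior x k i : 0 < delta0 -> good_set f Om eps Q x ->
  Q i (ziter f k x) -> rel_int Om (Q i) (ziter f k x).
Proof.
move=> delta0_gt0 [Omx xY] Qx; apply: (rel_int_of_not_boundary lps) => //.
- move=> bd; apply: xY; exists (- k) => //.
  by exists (ziter f k x); [left; exists i|exact: ziterK].
- move=> bd; apply: xY; exists (- k) => //.
  by exists (ziter f k x); [right; exists i|exact: ziterK].
Qed.

Lemma good_set_itinerary_unique x a b : 0 < delta0 -> good_set f Om eps Q x ->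
  is_itinerary f Q x a -> is_itinerary f Q x b -> a = b.
Proof.
move=> delta0_gt0 xY xa xb; apply/funext => k; apply/eqP/negP => /negP ab.
have [_ _ /(_ _ _ ab) + _] := markov; apply/eqP/set0P; exists (ziter f k x).
by split; exact: good_set_interior.
Qed.

End Coding.

(** * The coding map *)

Theorem theorem9p8 (R : realType) (n : nat) (M : riemannianManifold R n)
    (r : nat) (f : diffeomorphism M r) (Om : set M) :
  compact [set: M] -> (1 <= r)%N -> axiom_A f -> basic_set f Om ->
  exists2 eps0 : R, 0 < eps0 &
  forall (eps delta0 : R), 0 < eps -> eps <= eps0 -> 0 < delta0 ->
  local_product_structure f Om eps delta0 ->
  forall (m : nat) (Q : 'I_m -> set M),
  markov_partition f Om eps delta0 Q ->
  let A := transition_matrix f Om Q in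
  let Sigma_A := subshift A in
  let Y := good_set f Om eps Q in
  exists pi : (int -> 'I_m) -> M,
  [/\ continuous_on_subshift A pi /\ pi @` Sigma_A = Om,
      forall a, Sigma_A a -> pi (shift_map a) = f (pi a),
      forall a, Sigma_A a ->
        \bigcap_(k : int) (ziter f k @^-1` Q (a k)) = [set pi a],
      {in Sigma_A `&` pi @^-1` Y &, injective pi}
    & forall x, Y x -> exists2 a : int -> 'I_m,
        [set b | is_itinerary f Q x b] = [set a] &
        Sigma_A `&` pi @^-1` [set x] = [set a]].
Proof.
move=> Mcpt _ _ [k [B [[_ _ BP] [i0 BOm]]]].
have [Omn0 _ fOm _ _] := BP i0; rewrite BOm in Omn0 fOm.
have [x0 _] := Omn0.
have [[E [d [E0 d0 Elps]]]|nolps] := pselect (exists E d : R,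
    [/\ 0 < E, 0 < d & local_product_structure f Om E d]); last first.
  (* There is no scale to consider, so the value 1 is arbitrary. *)
  exists 1 => // eps d eps0 _ d0 lps; case: nolps.
  by exists eps, d.
(* Expansivity at scale [E] gives it at scale [3 * eps] if [eps <= E / 3]. *)
have Eexp := local_product_structure_expansive d0 Elps.
exists (E / 3); first by rewrite divr_gt0.
move=> eps delta0 eps0 epsE delta0_gt0 lps m Q markov A Sigma_A Y.
have Oexp : expansive_on f Om (3 * eps) by apply: expansive_onS Eexp; lra.
pose pi a := xget x0 (\bigcap_(k : int) (ziter f k @^-1` Q (a k))).
have piP a : Sigma_A a -> is_itinerary f Q (pi a) a.
  move=> aA.
  have [x xa] := admissible_intersection Mcpt fOm eps0 Oexp lps markov aA.
  have Ka : \bigcap_(k : int) (ziter f k @^-1` Q (a k)) !=set0.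
    by exists x => j _; exact: xa.
  by move=> j; exact: (xgetPex x0 Ka j I).
have pi_eq a x : Sigma_A a -> is_itinerary f Q x a -> pi a = x.
  by move=> /piP; apply: (itinerary_unique_point eps0 Oexp markov).
have fib x : Y x -> exists2 a : int -> 'I_m,
    [set b | is_itinerary f Q x b] = [set a] &
    Sigma_A `&` pi @^-1` [set x] = [set a].
  move=> Yx; have [a aA xa] := admissible_itinerary_exists fOm markov Yx.1.
  have itin : [set b | is_itinerary f Q x b] = [set a].
    apply/seteqP; split=> [b xb|_ -> //].
    exact: (good_set_itinerary_unique Mcpt lps markov delta0_gt0 Yx).
  exists a => //; rewrite -itin; apply/seteqP; split=> [b [bA <-]|b xb].
    exact: piP.
  have ba : b = a.
    by have : [set b | is_itinerary f Q x b] b := xb; rewrite itin.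
  by rewrite ba; split=> //; exact: pi_eq.
exists pi; split=> //.
- split.
    move=> a aA e e0.
    have [d1 d1_gt0 dP] :=
      itinerary_continuous Mcpt eps0 Oexp markov (piP a aA) e0.
    by exists d1 => // b bA; apply: dP; exact: piP.
  apply/seteqP; split=> [_ [a aA <-]|x Omx].
    have [QP _ _ _] := markov; have [[[QOm _ _] _ _] _] := QP (a 0).
    exact: QOm (piP a aA 0).
  have [a aA xa] := admissible_itinerary_exists fOm markov Omx.
  by exists a => //; exact: pi_eq.
- move=> a aA; apply: pi_eq => [j|j]; first exact: aA.
  by have := piP a aA (j + 1); rewrite ziterD.
- move=> a aA; apply/seteqP; split=> [x xP|_ -> j _]; last exact: piP.
  by rewrite /= -(pi_eq a x) // => j; exact: xP.
- move=> a b; rewrite !inE => -[aA Ya] [bA _] ab.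
  have [c _ cP] := fib _ Ya.
  have : (Sigma_A `&` pi @^-1` [set pi a]) a by [].
  have : (Sigma_A `&` pi @^-1` [set pi a]) b by [].
  by rewrite cP => -> ->.
Qed.
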